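(* Let $a$ and $b$ be distinct vertices of a graph $X$. Then $a$ and $b$ are strongly cospectral if and only if they are cospectral and all poles of the rational function $\phi(X\setminus\{a,b\},t)/\phi(X,t)$ are simple.
   Context: Graphs are finite, simple and undirected. For a graph $Y$ with adjacency matrix $A(Y)$, $\phi(Y,t)=\det(tI-A(Y))$ is its characteristic polynomial (equal to $1$ if $Y$ has no vertices). For $D\subseteq V(X)$, $X\setminus D$ is the graph obtained by deleting the vertices in $D$, and $X\setminus a$ means $X\setminus\{a\}$. Vertices $a,b$ are cospectral if $\phi(X\setminus a,t)=\phi(X\setminus b,t)$. Let $A=A(X)$ have distinct eigenvalues $\theta_1,\ldots,\theta_m$, and let $E_r$ be orthogonal projection onto the $\theta_r$-eigenspace; let $e_a$ be the standard basis vectors of $\mathbb{R}^{V(X)}$. Vertices $a,b$ are strongly cospectral if for each $r$ we have $E_re_a=E_re_b$ or $E_re_a=-E_re_b$. *)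

(* Defs.v *)
From HB Require Import structures.
From mathcomp Require Import all_boot all_order all_algebra.
From mathcomp Require Import fraction complex reals.

Set Implicit Arguments.
Unset Strict Implicit.
Unset Printing Implicit Defensive.

Import Order.TTheory GRing.Theory Num.Theory.
Local Open Scope ring_scope.

Record sgraph := SGraph {
  vertex :> finType;
  adj : rel vertex;
  adj_sym : symmetric adj;
  adj_irrefl : irreflexive adj
}.

Section Deletion.
Variables (X : sgraph) (D : {set X}).

Let del_adj : rel {x : X | x \notin D} := fun x y => adj (val x) (val y).

Fact del_adj_sym : symmetric del_adj.
Proof. by move=> x y; apply: adj_sym. Qed.

Fact del_adj_irrefl : irreflexive del_adj.
Proof. by move=> x; apply: adj_irrefl. Qed.

Definition del_vertices : sgraph := SGraph del_adj_sym del_adj_irrefl.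

End Deletion.

Section Spectrum.
Variable R : realType.

(* Rows and columns are indexed by the ranks of the vertices in enum X. *)
Definition adj_mx (X : sgraph) : 'M[R]_#|X| :=
  \matrix_(i, j) (adj (enum_val i) (enum_val j))%:R.

Definition phi (X : sgraph) : {poly R} := char_poly (adj_mx X).

Definition cospectral (X : sgraph) (a b : X) : Prop :=
  phi (del_vertices [set a]) = phi (del_vertices [set b]).

(* As everywhere in mxalgebra, vectors are rows, subspaces are row spaces and
   linear maps act by multiplication on the right; since adj_mx X is symmetric,
   its row eigenspaces are the transposes of its column eigenspaces. *)
Definition std_basis (X : sgraph) (a : X) : 'rV[R]_#|X| :=
  delta_mx 0 (enum_rank a).

(* kermx U^T consists of the rows u with u *m U^T = 0, i.e. it is the
   orthogonal complement of the row space of U. *)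
Definition orth_proj n (U : 'M[R]_n) : 'M[R]_n := proj_mx U (kermx U^T).

Lemma orth_projP n (U : 'M[R]_n) (v : 'rV[R]_n) :
  (v *m orth_proj U <= U)%MS /\ (v - v *m orth_proj U) *m U^T = 0.
Proof.
have rV0 (w : 'rV[R]_n) : w *m w^T = 0 -> w = 0.
  move=> /matrixP/(_ 0 0); rewrite !mxE => /eqP.
  rewrite psumr_eq0 => [/allP w0|i _]; last by rewrite mxE -expr2 sqr_ge0.
  apply/rowP => i; have /implyP/(_ isT) := w0 i (mem_index_enum i).
  by rewrite !mxE mulf_eq0 orbb => /eqP.
have cap0 : (U :&: kermx U^T = 0)%MS.
  apply/eqP/rowV0P => w; rewrite sub_capmx => /andP[/submxP[c ->]].
  move=> /sub_kermxP wU; apply: rV0.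
  by rewrite trmx_mul mulmxA wU mul0mx.
have full : (v <= U + kermx U^T)%MS.
  apply: submx_full; rewrite /row_full; apply/eqP.
  have /eqP := mxrank_sum_cap U (kermx U^T).
  rewrite cap0 mxrank0 addn0 mxrank_ker mxrank_tr => /eqP ->.
  by rewrite subnKC ?rank_leq_col.
split; first exact: proj_mx_sub.
by apply/sub_kermxP; apply: proj_mx_compl_sub.
Qed.

Definition strongly_cospectral (X : sgraph) (a b : X) : Prop :=
  forall theta : R, eigenvalue (adj_mx X) theta ->
    let E := orth_proj (eigenspace (adj_mx X) theta) in
    std_basis a *m E = std_basis b *m E \/
    std_basis a *m E = - (std_basis b *m E).

End Spectrum.

Definition has_pole_of_order (F : fieldType) (f : {fraction {poly F}})
    (z : F) (k : nat) : Prop :=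
  (0 < k)%N /\
  exists p q : {poly F}, [/\ ~~ root p z, ~~ root q z &
    f = tofrac p / tofrac (('X - z%:P) ^+ k * q)].

Definition all_poles_simple (F : fieldType) (f : {fraction {poly F}}) : Prop :=
  forall (z : F) (k : nat), has_pole_of_order f z k -> k = 1%N.

(* The quotient p / q, viewed as a rational function over the complex numbers,
   so that its poles are the complex ones. *)
Definition complex_ratfun (R : realType) (p q : {poly R}) :
    {fraction {poly R[i]}} :=
  tofrac (map_poly (real_complex R) p) / tofrac (map_poly (real_complex R) q).

(* Main.v *)
Require Import Defs.
From mathcomp Require Import all_boot all_order all_algebra.
From mathcomp Require Import ring perm spectral sesquilinear fraction complex reals.

(** Let A be the adjacency matrix, with orthogonal spectral projections E_r,
    one for each eigenvalue r. The resolvent is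
      (t - A)^-1 = sum_r E_r / (t - r),
    and Jacobi's theorem on complementary minors says that for a set D of
    vertices phi(X \ D) / phi(X) is the minor of the resolvent on D.

    For D = {a} this is sum_r (E_r)_aa / (t - r), so a and b are cospectral iff
    (E_r)_aa = (E_r)_bb for every r. For D = {a, b} it is the determinant of a
    2 x 2 matrix whose entries have at most simple poles, all of them at
    eigenvalues; hence the poles of phi(X \ {a, b}) / phi(X) have order at most
    two, and the coefficient of 1 / (t - r)^2 is
      (E_r)_aa (E_r)_bb - (E_r)_ab (E_r)_ba.
    As E_r is a symmetric idempotent, this is the Gram determinant of the vectors
    E_r e_a and E_r e_b. It vanishes iff they are parallel, and parallel
    vectors have equal norms iff they are equal or opposite, which is strong
    cospectrality.

    To stay within polynomials, the resolvent is multiplied by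
    P = prod_r (t - r): resolvent_mx is the matrix W with (t - A) W = P, and the
    value of W at r is a nonzero multiple of E_r. The lemmas that carry the proof
    are jacobi_minor, rows_parallelE, char_mx_resolvent and all_poles_simpleE. *)

Set Implicit Arguments.
Unset Strict Implicit.
Unset Printing Implicit Defensive.

Import Order.TTheory GRing.Theory Num.Theory.
Local Open Scope ring_scope.

(** * Principal minors and the complementary minor theorem *)

Lemma det_mxsub_bij (R : comNzRingType) m n (f : 'I_m -> 'I_n) (A : 'M[R]_n) :
  bijective f -> \det (mxsub f f A) = \det A.
Proof.
move=> bij_f; have eq_mn : m = n by have := bij_eq_card bij_f; rewrite !card_ord.
case: _ / eq_mn in f A bij_f *.
have inj_f := bij_inj bij_f.
have -> : mxsub f f A = row_perm (perm inj_f) (col_perm (perm inj_f) A).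
  by apply/matrixP => i j; rewrite !mxE !permE.
rewrite row_permE col_permE !det_mulmx !det_perm mulrCA -signr_addb.
by rewrite odd_permV addbb mulr1.
Qed.

Lemma mxsub_mul_bij (R : pzSemiRingType) m n (f : 'I_m -> 'I_n) (A B : 'M[R]_n) :
  bijective f -> mxsub f f (A *m B) = mxsub f f A *m mxsub f f B.
Proof.
move=> bij_f; apply/matrixP => i j; rewrite !mxE (reindex f); last exact: onW_bij.
by apply: eq_bigr => k _; rewrite !mxE.
Qed.

(** Jacobi's complementary minor theorem, for M invertible up to the scalar c.
    Replacing the first k rows of M by unit rows gives a matrix with determinant
    det (drsubmx M), and multiplying that by W keeps the first k rows of W and
    puts c on the rest of the diagonal. *)
Lemma jacobi_minor (R : idomainType) k l (M W : 'M[R]_(k + l)) (c : R) :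
  c != 0 -> M *m W = c%:M ->
  \det (drsubmx M) * c ^+ k = \det M * \det (ulsubmx W).
Proof.
move=> c_n0 MW.
have detMW : \det M * \det W = c ^+ (k + l) by rewrite -det_mulmx MW det_scalar.
have W_n0 : \det W != 0.
  by apply: contra_neq (expf_neq0 (k + l) c_n0) => W0; rewrite -detMW W0 mulr0.
have MW' : block_mx 1%:M 0 (dlsubmx M) (drsubmx M) *m W =
           block_mx (ulsubmx W) (ursubmx W) 0 c%:M.
  have := MW; rewrite -{1}[M]submxK -{1 2}[W]submxK scalar_mx_block !mulmx_block.
  by move=> /eq_block_mx[_ _ -> ->]; rewrite !mul1mx !mul0mx !addr0.
apply: (mulIf W_n0); rewrite mulrAC.
have := congr1 determinant MW'; rewrite det_mulmx det_lblock det1 mul1r.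
rewrite det_ublock det_scalar => ->.
by rewrite [RHS]mulrAC detMW [RHS]mulrC -mulrA -exprD addnC.
Qed.

Lemma det_mx22 (R : comNzRingType) (A : 'M[R]_2) :
  \det A = A 0 0 * A 1 1 - A 0 1 * A 1 0.
Proof.
rewrite (expand_det_row _ 0) !big_ord_recl big_ord0 addr0 /cofactor !det_mx11.
rewrite !mxE /= expr0 expr1 mul1r mulN1r mulrN.
by congr (A _ _ * A _ _ - A _ _ * A _ _); apply/val_inj.
Qed.

(** * Orthogonal projections *)

Section OrthProj.
Variables (R : realType) (n : nat) (U : 'M[R]_n).
Local Notation E := (orth_proj U).

Lemma orth_proj_sub : (E <= U)%MS.
Proof.
apply/row_subP => i; rewrite rowE.
by have [] := orth_projP U (delta_mx 0 i).
Qed.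

Lemma orth_proj_compl : (1%:M - E) *m U^T = 0.
Proof.
apply/row_matrixP => i; rewrite row_mul linearB /= row1 row0 [row i E]rowE.
by have [] := orth_projP U (delta_mx 0 i).
Qed.

Lemma orth_proj_sym : E^T = E.
Proof.
have [K defE] := submxP orth_proj_sub.
have /eqP : (1%:M - E) *m E^T = 0.
  by rewrite {2}defE trmx_mul mulmxA orth_proj_compl mul0mx.
rewrite mulmxBl mul1mx subr_eq0 => /eqP EtE.
by rewrite EtE -{1}[E]trmxK -trmx_mul -EtE trmxK.
Qed.

Lemma orth_proj_id : U *m E = U.
Proof.
have := congr1 trmx orth_proj_compl; rewrite trmx_mul trmxK linearB /= trmx1.
rewrite trmx0 orth_proj_sym mulmxBr mulmx1 => /eqP.
by rewrite subr_eq0 => /eqP.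
Qed.

Lemma orth_proj_idem : E *m E = E.
Proof.
have [K defE] := submxP orth_proj_sub.
by rewrite {1}defE -mulmxA orth_proj_id -defE.
Qed.

End OrthProj.

(** Entry (k, l) of E = E E^T is the inner product of rows k and l, so the
    2 x 2 determinant is the Gram determinant of rows i and j. If these rows have
    the same norm and a zero Gram determinant, then E i j = s (E i i) for a sign
    s, and (row i) - s (row j) has norm zero. *)
Lemma rows_parallelE (R : realDomainType) n (E : 'M[R]_n) (i j : 'I_n) :
  E^T = E -> E *m E = E ->
  (row i E = row j E \/ row i E = - row j E) <->
  E i i = E j j /\ E i i * E j j - E i j * E j i = 0.
Proof.
move=> E_sym E_idem.
have Eji : E j i = E i j by rewrite -{1}E_sym mxE.
have dotE k l : \sum_m E k m * E l m = E k l.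
  rewrite -[in RHS]E_idem mxE; apply: eq_bigr => m _.
  by rewrite -{2}E_sym mxE.
split=> [[]/rowP eq_ij|[eq_d /eqP]].
- have := eq_ij i; have := eq_ij j; rewrite !mxE Eji => <- ->.
  by rewrite subrr.
- have := eq_ij i; have := eq_ij j; rewrite !mxE Eji => -> ->.
  by rewrite !opprK mulrNN subrr.
rewrite Eji -eq_d -!expr2 subr_eq0 eqf_sqr => Eij.
have [s s2 Eij_s] : exists2 s : R, s * s = 1 & E i j = s * E i i.
  case/orP: Eij => /eqP eq_ij; [exists 1|exists (-1)]; rewrite ?mulrNN ?mulr1 //.
    by rewrite mul1r.
  by rewrite eq_ij mulN1r opprK.
have v0 k : E i k = s * E j k.
  apply/eqP; rewrite -subr_eq0 -sqrf_eq0; apply/eqP.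
  have : \sum_m (E i m - s * E j m) ^+ 2 = 0.
    have -> : \sum_m (E i m - s * E j m) ^+ 2 =
        \sum_m E i m * E i m - (s * \sum_m E i m * E j m) *+ 2
          + s * s * \sum_m E j m * E j m.
      rewrite !mulr_sumr -sumrMnl -sumrB -big_split; apply: eq_bigr => m _ /=.
      by ring.
    rewrite !dotE -eq_d Eij_s mulrA s2 !mul1r.
    by ring.
  by move/psumr_eq0P => -> // m _; exact: sqr_ge0.
have /eqP : s ^+ 2 = 1 ^+ 2 by rewrite expr1n.
rewrite eqf_sqr => /orP[]/eqP def_s; [left|right]; apply/rowP => k;
  by rewrite !mxE v0 def_s ?mul1r ?mulN1r.
Qed.

(** * Spectral decomposition of a real symmetric matrix *)

Section SymmetricMatrix.
Variables (R : realType) (n : nat) (A : 'M[R]_n).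
Hypothesis A_sym : A^T = A.

(** The spectral theorem for Hermitian matrices diagonalises A over the complex
    numbers with real eigenvalues. The minimal polynomial does not change under
    field extension, so it is already over R a product of distinct linear
    factors, and A is diagonalisable over R. *)
Lemma symmetric_eigenspaces_full :
  exists2 rs : seq R, uniq rs & (\sum_(r <- rs) eigenspace A r :=: 1%:M)%MS.
Proof.
apply/diagonalizablePeigen.
case: n A A_sym => [|n'] B B_sym; first by rewrite [B]flatmx0; exact: diagonalizable0.
pose BC := map_mx (real_complex R) B.
have BC_herm : BC \is hermsymmx.
  apply: realsym_hermsym.
    by apply/is_hermitianmxP; rewrite expr0 scale1r map_mx_id // map_trmx B_sym.
  by apply/mxOverP => i j; rewrite mxE; apply/complex_realP; exists (B i j).
have /orthomx_spectralP defBC := hermitian_normalmx BC_herm.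
have /mxOverP d_real := hermitian_spectral_diag_real BC_herm.
pose d := map_mx (@complex.Re R) (spectral_diag BC).
have defd : spectral_diag BC = map_mx (real_complex R) d.
  apply/matrixP => i j; rewrite !mxE.
  by apply/esym; have /complex_realP[x ->] := d_real i j.
have minB : map_poly (real_complex R) (mxminpoly B) =
    map_poly (real_complex R)
      (\prod_(r <- undup [seq d 0 i | i <- enum 'I_n'.+1]) ('X - r%:P)).
  rewrite -mxminpoly_map -/BC defBC -conjVmx ?spectral_unit //.
  rewrite mxminpoly_uconj ?unitmx_inv ?spectral_unit //.
  rewrite mxminpoly_diag rmorph_prod /=.
  have -> : [seq spectral_diag BC 0 i | i <- enum 'I_n'.+1] =
            map (real_complex R) [seq d 0 i | i <- enum 'I_n'.+1].
    by rewrite -[RHS]map_comp; apply: eq_map => i; rewrite defd mxE.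
  rewrite undup_map_inj; last exact: fmorph_inj.
  by rewrite big_map; apply: eq_bigr => r _; rewrite map_polyXsubC.
apply/diagonalizableP; exists (undup [seq d 0 i | i <- enum 'I_n'.+1]).
  exact: undup_uniq.
by rewrite (map_poly_inj _ minB).
Qed.

Definition spectral_proj (r : R) : 'M[R]_n := orth_proj (eigenspace A r).
Local Notation E := spectral_proj.

Lemma spectral_proj_mul r : E r *m A = r *: E r.
Proof. exact/eigenspaceP/orth_proj_sub. Qed.

Lemma mul_spectral_proj r : A *m E r = r *: E r.
Proof.
by have := congr1 trmx (spectral_proj_mul r);
  rewrite trmx_mul linearZ /= orth_proj_sym A_sym.
Qed.

(** With U the r-eigenspace, U A E_s can be computed in two ways, as r (U E_s)
    and as s (U E_s). *)
Lemma eigenspace_spectral_proj0 r s : r != s -> eigenspace A r *m E s = 0.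
Proof.
move=> rs; have /eqP := congr1 (mulmx^~ (E s)) (eigenspaceP (submx_refl (eigenspace A r))).
rewrite -mulmxA mul_spectral_proj -scalemxAr -scalemxAl -subr_eq0 -scalerBl.
by rewrite scaler_eq0 subr_eq0 eq_sym (negPf rs) => /eqP.
Qed.

(* The list rs contains every eigenvalue of A, but possibly also numbers r that
   are not eigenvalues; for these E r = 0. *)
Variable rs : seq R.
Hypotheses (rs_uniq : uniq rs)
  (rs_full : (\sum_(r <- rs) eigenspace A r :=: 1%:M)%MS).

(** The sum fixes every eigenspace, and these span the whole space. *)
Lemma sum_spectral_proj : \sum_(r <- rs) E r = 1%:M.
Proof.
apply/eqP; rewrite -subr_eq0; apply/eqP.
rewrite -[LHS]mul1mx; apply/sub_kermxP; rewrite -rs_full.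
rewrite big_seq; elim/big_ind: _ => [|U V sU sV|r r_rs]; first exact: sub0mx.
  by rewrite addsmx_sub sU.
apply/sub_kermxP; rewrite mulmxBr mulmx1 mulmx_sumr (bigD1_seq r) //=.
rewrite big1 ?addr0 => [|s sr]; last by rewrite eigenspace_spectral_proj0 // eq_sym.
by rewrite orth_proj_id subrr.
Qed.

Definition spectral_poly : {poly R} := \prod_(r <- rs) ('X - r%:P).
Definition spectral_copoly r : {poly R} := \prod_(s <- rs | s != r) ('X - s%:P).

(** The resolvent of A with denominators cleared: spectral_poly times the
    matrix sum_r E_r / ('X - r). *)
Definition resolvent_mx : 'M[{poly R}]_n :=
  \sum_(r <- rs) spectral_copoly r *: map_mx polyC (E r).

Lemma spectral_polyE r : r \in rs -> spectral_poly = ('X - r%:P) * spectral_copoly r.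
Proof. by move=> r_rs; rewrite /spectral_poly (bigD1_seq r). Qed.

Lemma spectral_poly_neq0 : spectral_poly != 0.
Proof. by rewrite monic_neq0 // monic_prod_XsubC. Qed.

Lemma spectral_copoly_root r : ~~ root (spectral_copoly r) r.
Proof.
rewrite /root horner_prod prodf_seq_neq0; apply/allP => s _.
by apply/implyP => sr; rewrite hornerXsubC subr_eq0 eq_sym.
Qed.

Lemma char_mx_resolvent : char_poly_mx A *m resolvent_mx = spectral_poly%:M.
Proof.
have comp_r r : r \in rs -> char_poly_mx A *m (spectral_copoly r *: map_mx polyC (E r))
    = spectral_poly *: map_mx polyC (E r).
  move=> r_rs; rewrite -scalemxAr mulmxBl mul_scalar_mx -map_mxM mul_spectral_proj.
  by rewrite map_mxZ -scalerBl scalerA mulrC -spectral_polyE.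
rewrite mulmx_sumr big_seq (eq_bigr _ comp_r) -big_seq -scaler_sumr.
by rewrite -map_mx_sum sum_spectral_proj map_mx1 scalemx1.
Qed.

(** Every spectral_copoly s with s != r vanishes at r, so evaluation at r isolates
    E_r, like taking a residue of the resolvent. *)
Lemma horner_resolvent r i j : r \in rs ->
  (resolvent_mx i j).[r] = (spectral_copoly r).[r] * E r i j.
Proof.
move=> r_rs.
have entryE s : (spectral_copoly s *: map_mx polyC (E s)) i j =
    spectral_copoly s * (E s i j)%:P by rewrite [LHS]mxE [in LHS]mxE.
rewrite summxE horner_sum (bigD1_seq r) //= entryE hornerM hornerC.
rewrite big1 ?addr0 // => s sr; rewrite entryE hornerM.
have -> : (spectral_copoly s).[r] = 0; last by rewrite mul0r.
rewrite /spectral_copoly (big_rem r) //= eq_sym sr hornerM.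
by rewrite hornerXsubC subrr mul0r.
Qed.

End SymmetricMatrix.

(** * Characteristic polynomials of vertex-deleted graphs *)

Lemma adj_mx_sym (R : realType) (X : sgraph) : (adj_mx R X)^T = adj_mx R X.
Proof. by apply/matrixP => i j; rewrite !mxE adj_sym. Qed.

Lemma phi_neq0 (R : realType) (X : sgraph) : phi R X != 0.
Proof. exact/monic_neq0/char_poly_monic. Qed.

(** Jacobi's theorem for 'X - A, after the vertices have been reordered so that
    those of D, listed by f, come before the vertices of X \ D. *)
Lemma phi_del (R : realType) (X : sgraph) (D : {set X}) k (f : 'I_k -> X)
    (W : 'M[{poly R}]_#|X|) (c : {poly R}) :
  injective f -> (forall x, (x \in D) = (x \in codom f)) ->
  c != 0 -> char_poly_mx (adj_mx R X) *m W = c%:M ->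
  phi R (del_vertices D) * c ^+ k =
  phi R X * \det (mxsub (enum_rank \o f) (enum_rank \o f) W).
Proof.
move=> f_inj defD c_n0 MW; set Y := del_vertices D.
pose h (i : 'I_(k + #|Y|)) : 'I_#|X| := enum_rank
  (match split i with inl i1 => f i1 | inr i2 => val (enum_val i2 : Y) end).
have h_inj : injective h.
  move=> i j /enum_rank_inj; move: (splitK i) (splitK j).
  case: (split i) (split j) => [i1|i2] [j1|j2] <- <-.
  - by move=> /f_inj ->.
  - move=> eq_f; have := valP (enum_val j2 : Y).
    by rewrite /= -eq_f defD codom_f.
  - move=> eq_f; have := valP (enum_val i2 : Y).
    by rewrite /= eq_f defD codom_f.
  - by move=> /val_inj/enum_val_inj ->.
have h_bij : bijective h.
  apply: inj_card_bij => //; rewrite !card_ord.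
  have -> : #|Y| = #|[pred x | x \notin D]| by exact: card_sig.
  rewrite -[leqLHS](cardC (mem (codom f))) card_codom // card_ord leq_add2l.
  by apply/eq_leq/eq_card => x; rewrite !inE defD.
have hl i : h (lshift _ i) = enum_rank (f i).
  by rewrite /h (unsplitK (inl i : 'I_k + 'I_#|Y|)).
have hr i : h (rshift _ i) = enum_rank (val (enum_val i : Y)).
  by rewrite /h (unsplitK (inr i : 'I_k + 'I_#|Y|)).
have /(jacobi_minor c_n0) : mxsub h h (char_poly_mx (adj_mx R X)) *m mxsub h h W = c%:M.
  rewrite -mxsub_mul_bij // MW; apply/matrixP => i j.
  by rewrite !mxE (inj_eq h_inj).
rewrite det_mxsub_bij // => jac.
rewrite /phi /char_poly -/Y; set N := char_poly_mx (adj_mx R X) in jac *.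
have <- : drsubmx (mxsub h h N) = char_poly_mx (adj_mx R Y).
  apply/matrixP => i j; rewrite !mxE !hr !enum_rankK.
  by rewrite (inj_eq enum_rank_inj) (inj_eq val_inj) (inj_eq enum_val_inj).
rewrite jac; congr (_ * \det _).
by apply/matrixP => i j; rewrite !mxE !hl.
Qed.

Lemma phi_del1 (R : realType) (X : sgraph) (a : X) (W : 'M[{poly R}]_#|X|) c :
  c != 0 -> char_poly_mx (adj_mx R X) *m W = c%:M ->
  phi R (del_vertices [set a]) * c = phi R X * W (enum_rank a) (enum_rank a).
Proof.
move=> c_n0 MW.
have := @phi_del R X [set a] 1 (fun=> a) W c; rewrite det_mx11 mxE expr1; apply => //.
  by move=> i j _; rewrite !ord1.
move=> x; rewrite inE; apply/eqP/codomP => [->|[_ ->] //].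
by exists 0.
Qed.

Lemma phi_del2 (R : realType) (X : sgraph) (a b : X) (W : 'M[{poly R}]_#|X|) c :
  a != b -> c != 0 -> char_poly_mx (adj_mx R X) *m W = c%:M ->
  let i := enum_rank a in let j := enum_rank b in
  phi R (del_vertices [set a; b]) * c ^+ 2 =
  phi R X * (W i i * W j j - W i j * W j i).
Proof.
move=> hab c_n0 MW i j.
have := @phi_del R X [set a; b] 2 (fun i => if i == 0 then a else b) W c.
rewrite det_mx22 !mxE /=; apply => //.
  case=> [[|[|//]] ?] [[|[|//]] ?] /= eq_ab; apply/val_inj => //=;
    by move: hab; rewrite eq_ab eqxx.
move=> x; rewrite !inE; apply/orP/codomP => [[]/eqP-> |[k ->]].
- by exists 0.
- by exists 1.
by case: ifP => _; [left|right].
Qed.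

(** * Poles of rational functions with a split denominator *)

(** If g / Q = p / (('X - z) ^ k * q) in lowest terms at z, then ('X - z) ^ k divides
    p * Q and is coprime to p, so it divides Q. *)
Lemma all_poles_simple_squarefree (F : fieldType) (g Q : {poly F}) :
  Q != 0 -> (forall z, ~~ (('X - z%:P) ^+ 2 %| Q)) ->
  all_poles_simple (tofrac g / tofrac Q).
Proof.
move=> Q_n0 Q_sqf z [|[|k]] // [] // _ [p [q [pz qz]]].
have Xk_n0 : ('X - z%:P) ^+ k.+2 * q != 0.
  rewrite mulf_neq0 ?expf_neq0 ?polyXsubC_eq0 //.
  by apply: contraNneq qz => ->; rewrite root0.
move=> /eqP; rewrite eqr_div ?tofrac_eq0 // -!tofracM tofrac_eq => /eqP eq_gp.
case/negP: (Q_sqf z).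
have : ('X - z%:P) ^+ 2 %| p * Q.
  by rewrite -eq_gp dvdp_mull // dvdp_mulr // dvdp_exp2l.
by rewrite Gauss_dvdpr // coprimep_expl // coprimep_sym coprimep_XsubC.
Qed.

Lemma prod_XsubC_squarefree (F : fieldType) (rs : seq F) (z : F) :
  uniq rs -> ~~ (('X - z%:P) ^+ 2 %| \prod_(r <- rs) ('X - r%:P)).
Proof.
move=> rs_uniq; apply/negP => sq_dvd.
have z_rs : z \in rs.
  rewrite -root_prod_XsubC -dvdp_XsubCl (dvdp_trans _ sq_dvd) //.
  by rewrite expr2 dvdp_mulr.
have := sq_dvd; rewrite (big_rem z) //= expr2 dvdp_mul2l ?polyXsubC_eq0 //.
by rewrite dvdp_XsubCl root_prod_XsubC mem_rem_uniqF.
Qed.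

(** Here p / q = g / P ^ 2, where P is the product of the 'X - r, so every pole
    has order at most two. A root of P that is not a root of g is a pole of
    order two; if g vanishes at all roots of P, then one factor P cancels and the
    denominator that remains is squarefree, even over the complex numbers. *)
Lemma all_poles_simpleE (R : realType) (rs : seq R) (p q g : {poly R}) :
  uniq rs -> q != 0 -> p * spectral_poly rs ^+ 2 = q * g ->
  all_poles_simple (complex_ratfun p q) <-> {in rs, forall r, root g r}.
Proof.
move=> rs_uniq q_n0 pq.
pose iota := map_poly (real_complex R); set P := spectral_poly rs in pq *.
have P_n0 : P != 0 := spectral_poly_neq0 rs.
have iota_n0 s : s != 0 -> tofrac (iota s) != 0.
  by move=> s_n0; rewrite tofrac_eq0 map_poly_eq0.
split=> [simple r r_rs | g_root].
  apply: contraT => gr_n0.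
  suff /simple : has_pole_of_order (complex_ratfun p q) (real_complex R r) 2 by [].
  split=> //; exists (iota g), (iota (spectral_copoly rs r) ^+ 2); split.
  - by rewrite fmorph_root.
  - by rewrite -rmorphXn fmorph_root /root horner_exp expf_neq0 // spectral_copoly_root.
  rewrite -exprMn -map_polyXsubC -rmorphM -spectral_polyE // -rmorphXn.
  apply/eqP; rewrite eqr_div ?iota_n0 ?expf_neq0 //.
  by rewrite -!tofracM -!rmorphM pq mulrC.
have /dvdpP[g' defg] : P %| g.
  by apply: uniq_roots_dvdp; [exact/allP | rewrite uniq_rootsE].
have -> : complex_ratfun p q = tofrac (iota g') / tofrac (iota P).
  apply/eqP; rewrite eqr_div ?iota_n0 // -!tofracM -!rmorphM tofrac_eq.
  apply/eqP; congr iota; apply: (mulIf P_n0).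
  by rewrite -mulrA -expr2 pq defg mulrA [q * _]mulrC.
apply: all_poles_simple_squarefree => [|z]; first by rewrite map_poly_eq0.
rewrite /iota rmorph_prod /=.
under eq_bigr do rewrite map_polyXsubC.
rewrite -(big_map (real_complex R) xpredT (fun r => 'X - r%:P)).
by apply: prod_XsubC_squarefree; rewrite map_inj_uniq //; exact: fmorph_inj.
Qed.

(** * Cospectrality in terms of the spectral projections *)

Section StronglyCospectral.
Variables (R : realType) (X : sgraph) (a b : X).
Local Notation A := (adj_mx R X).
Local Notation i := (enum_rank a).
Local Notation j := (enum_rank b).
Variable rs : seq R.
Hypotheses (rs_uniq : uniq rs)
  (rs_full : (\sum_(r <- rs) eigenspace A r :=: 1%:M)%MS).
Local Notation E := (spectral_proj A).
Local Notation W := (resolvent_mx A rs).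

(** The condition at an element of rs that is not an eigenvalue is vacuous,
    because the projection is zero there; conversely every eigenvalue is in
    rs, because the projections for rs sum to the identity. *)
Lemma strongly_cospectral_entries :
  strongly_cospectral R a b <->
  {in rs, forall r, E r i i = E r j j /\
                    E r i i * E r j j - E r i j * E r j i = 0}.
Proof.
have rowsE r := rows_parallelE i j (orth_proj_sym (eigenspace A r))
                  (orth_proj_idem (eigenspace A r)).
split=> [sc r _|entries r r_eig].
  apply/rowsE; have [r_eig|] := boolP (eigenvalue A r).
    by have := sc r r_eig; rewrite /std_basis -!rowE.
  rewrite negbK => /eqP U0; left.
  have /submxP[K ->] := orth_proj_sub (eigenspace A r).
  by rewrite U0 mulmx0 !row0.
rewrite /std_basis -!rowE; apply/rowsE/entries.
apply: contraT => r_rs; case/negP: r_eig; apply/eqP.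
rewrite -[LHS]mulmx1 -(sum_spectral_proj (adj_mx_sym R X) rs_uniq rs_full).
rewrite mulmx_sumr big_seq big1 // => s s_rs.
rewrite eigenspace_spectral_proj0 ?adj_mx_sym //.
by apply: contraNneq r_rs => ->.
Qed.

Lemma cospectral_entries :
  cospectral R a b <-> {in rs, forall r, E r i i = E r j j}.
Proof.
have MW := char_mx_resolvent (adj_mx_sym R X) rs_uniq rs_full.
have P_n0 := spectral_poly_neq0 rs.
have del c := phi_del1 c P_n0 MW.
have -> : cospectral R a b <-> W i i = W j j.
  split=> [cosp|eqW]; first by apply: (mulfI (phi_neq0 R X)); rewrite -!del cosp.
  by apply: (mulIf P_n0); rewrite !del eqW.
split=> [eqW r r_rs|eqE].
  have /(congr1 (horner^~ r)) := eqW; rewrite /= !horner_resolvent //.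
  exact/mulfI/spectral_copoly_root.
rewrite !summxE; apply: eq_big_seq => r r_rs.
by rewrite [LHS]mxE [in LHS]mxE [RHS]mxE [in RHS]mxE eqE.
Qed.

Lemma all_poles_simple_entries : a != b ->
  all_poles_simple (complex_ratfun (phi R (del_vertices [set a; b])) (phi R X))
  <-> {in rs, forall r, E r i i * E r j j - E r i j * E r j i = 0}.
Proof.
move=> hab; have MW := char_mx_resolvent (adj_mx_sym R X) rs_uniq rs_full.
have del := phi_del2 hab (spectral_poly_neq0 rs) MW.
have rootE r : r \in rs -> root (W i i * W j j - W i j * W j i) r =
    (E r i i * E r j j - E r i j * E r j i == 0).
  move=> r_rs; rewrite /root hornerD hornerN !hornerM !horner_resolvent //.
  rewrite ![_ * E _ _ _ * _]mulrACA -mulrBr mulf_eq0 -expr2 sqrf_eq0.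
  by have := spectral_copoly_root rs r; rewrite /root => /negPf->.
rewrite (all_poles_simpleE rs_uniq (phi_neq0 R X) del).
split=> ok r r_rs; first by apply/eqP; rewrite -rootE // ok.
by rewrite rootE // ok.
Qed.

End StronglyCospectral.

Theorem corollary8p4 (R : realType) (X : sgraph) (a b : X) (hab : a != b) :
  strongly_cospectral R a b <->
  cospectral R a b /\
  all_poles_simple
    (complex_ratfun (phi R (del_vertices [set a; b])) (phi R X)).
Proof.
have [rs rs_uniq rs_full] := symmetric_eigenspaces_full (adj_mx_sym R X).
rewrite (strongly_cospectral_entries a b rs_uniq rs_full).
rewrite (cospectral_entries a b rs_uniq rs_full).
rewrite (all_poles_simple_entries rs_uniq rs_full hab).
split=> [ok|[ok1 ok2] r r_rs].
  by split=> r /ok[].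
by split; [exact: ok1 | exact: ok2].
Qed.
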